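(* Let $X$ be a smooth complex projective surface, $\omega\in\mathrm{NS}(X)$ ample, $\gamma\in\mathrm{NS}_{\mathbb Q}(X)$ orthogonal to $\omega$, $g=\omega^2$, $d=-\gamma^2$, and $u\in\mathbb R$. Let $v=(x,\,y_1\omega+y_2\gamma+\alpha,\,z)$, $\alpha\in\langle\omega,\gamma\rangle^\perp$, be a Bogomolov class, and suppose that either $x>0$ and $$F=\frac dg\Bigl(u-\frac{y_2}{x}\Bigr)^2+\frac1{x^2g}\bigl(y_1^2g-y_2^2d-2xz\bigr)>0,$$ or $x=0$ and $y_1>0$. Then any (semicircular) real pseudo-wall for $v$ in the half-plane $\Pi_{\gamma,\omega,u}$ (lying, if $x>0$, in the region $s<y_1/x$) must intersect the line $s=C_0$, where $$C_0=\begin{cases}\dfrac{y_1}{x}-\sqrt F&\text{if }x>0,\\[2mm] \dfrac{z+duy_2}{gy_1}&\text{if }x=0\text{ and }y_1>0.\end{cases}$$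
   Context: $\mathrm N(X)$ is the numerical Grothendieck group of $X$, identified with $\mathbb Z\oplus\mathrm{NS}(X)\oplus\mathbb Z[\tfrac12]$ by (rank, $c_1$, $\mathrm{ch}_2$); $\mathrm N_{\mathbb R}(X)=\mathrm N(X)\otimes\mathbb R$. A class $v=(r,c_1,\mathrm{ch}_2)\in\mathrm N_{\mathbb R}(X)$ is a Bogomolov class if $c_1^2\ge 2r\,\mathrm{ch}_2$. If $\gamma=0$ (e.g. if $\rho(X)=1$) we take $y_2=0$, $d=0$, $\alpha\in\omega^\perp$. For $s\in\mathbb R$, $t>0$ set $Z=Z_{s\omega+u\gamma,t\omega}$, where $$Z_{\beta,\omega}(r,\theta,z)=-z+\theta\cdot\beta-\tfrac r2(\beta^2-\omega^2)+i(\theta-r\beta)\cdot\omega,\qquad \mu_Z=-\mathrm{Re}\,Z/\mathrm{Im}\,Z .$$ The half-plane $\Pi_{\gamma,\omega,u}$ consists of the stability conditions with central charge $Z_{s\omega+u\gamma,t\omega}$, $s\in\mathbb R$, $t>0$, with coordinates $(s,t)$. For $w\in\mathrm N_{\mathbb R}(X)$ not proportional to $v$, the real pseudo-wall of $w$ is the set of $(s,t)$ with $t>0$ at which $\mu_Z(w)=\mu_Z(v)$ (with denominators cleared); when it is a non-empty semicircle centred on $t=0$ it is called semicircular. *)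

(* Defs.v *)
From HB Require Import structures.
From mathcomp Require Import all_boot all_order all_algebra.
From mathcomp Require Import classical_sets reals.
From mathcomp Require Import complex.

Set Implicit Arguments.
Unset Strict Implicit.
Unset Printing Implicit Defensive.

Import Order.TTheory GRing.Theory Num.Theory.
Local Open Scope classical_set_scope.
Local Open Scope ring_scope.

(* Intersection number of two row vectors, with respect to the Gram matrix G of
   an integral bilinear form; K is any coefficient ring (int, rat, R). *)
Definition gram_dot (K : comNzRingType) (n : nat) (G : 'M[int]_n)
    (D E : 'rV[K]_n) : K :=
  (D *m map_mx intr G *m E^T) 0 0.

(* The numerical data of a smooth complex projective surface X: the lattice
   NS(X) of divisor classes modulo numerical equivalence, in a Z-basis, so that
   NS(X) = Z^rho; its intersection form, given by the Gram matrix of the basis;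
   and the set of ample classes.  The ample set is a primitive of the structure
   and is only subject to properties that hold on every such surface.
   - projectivity: there is an ample class;
   - ample classes are closed under sums and have positive intersection;
   - Hodge index theorem: the form is negative definite on the orthogonal of an
     ample class.  (With [ample_dot_gt0] and [ample_ex] this makes the form
     nondegenerate, of signature (1, rho - 1).) *)
Record surface := Surface {
  rho : nat;
  gram : 'M[int]_rho;
  ample : set 'rV[int]_rho;
  gram_sym : gram^T = gram;
  ample_ex : exists H, ample H;
  ampleD : forall H H', ample H -> ample H' -> ample (H + H');
  ample_dot_gt0 : forall H H', ample H -> ample H' -> 0 < gram_dot gram H H';
  hodge_index : forall H D, ample H -> gram_dot gram D H = 0 -> D != 0 ->
    gram_dot gram D D < 0
}.

(* NS(X), NS_Q(X) and NS_R(X) are [NS X int], [NS X rat] and [NS X R]. *)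
Notation NS X K := 'rV[K]_(rho X).

Definition dot (X : surface) (K : comNzRingType) (D E : NS X K) : K :=
  gram_dot (gram X) D E.

Definition NS_of_int (X : surface) (R : realType) (D : NS X int) : NS X R :=
  map_mx intr D.

Definition NS_of_rat (X : surface) (R : realType) (D : NS X rat) : NS X R :=
  map_mx ratr D.

(* N_R(X), with coordinates (rank, c_1, ch_2); R^o is R as a vector space over
   itself. *)
Notation NR X R := (R^o * NS X R * R^o)%type.

Section Numerical.
Variables (R : realType) (X : surface).
Implicit Types (beta om ga th : NS X R) (v w : NR X R).

Definition bogomolov v : Prop :=
  let: (r, c1, ch2) := v in 2 * r * ch2 <= dot c1 c1.

(* For v <> 0, [w] is not proportional to [v] iff v and w are linearly
   independent. *)
Definition proportional v w : Prop := exists k : R, w = k *: v.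

Definition central_charge beta om v : R[i] :=
  let: (r, th, z) := v in
  ((- z + dot th beta - r / 2 * (dot beta beta - dot om om))
    +i* dot (th - r *: beta) om)%C.

Definition half_plane : set (R * R) := [set p | 0 < p.2].

Definition plane_charge om ga (u : R) (p : R * R) : NR X R -> R[i] :=
  central_charge (p.1 *: om + u *: ga) (p.2 *: om).

(* The equation mu_Z(w) = mu_Z(v), where mu_Z = - Re Z / Im Z, with
   denominators cleared. *)
Definition same_slope (Z : NR X R -> R[i]) v w : Prop :=
  - complex.Re (Z w) * complex.Im (Z v) = - complex.Re (Z v) * complex.Im (Z w).

Definition pseudo_wall om ga (u : R) v w : set (R * R) :=
  [set p | half_plane p /\ same_slope (plane_charge om ga u p) v w].

End Numerical.

Definition semicircular (R : realType) (W : set (R * R)) : Prop :=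
  exists c rad : R, 0 < rad /\
    W = [set p | half_plane p /\ (p.1 - c) ^+ 2 + p.2 ^+ 2 = rad ^+ 2].

Definition wall_F (R : realType) (g d u x y1 y2 z : R) : R :=
  d / g * (u - y2 / x) ^+ 2
  + (x ^+ 2 * g)^-1 * (y1 ^+ 2 * g - y2 ^+ 2 * d - 2 * x * z).

(* The second branch is only meaningful when x = 0 and y1 > 0. *)
Definition wall_C0 (R : realType) (g d u x y1 y2 z : R) : R :=
  if 0 < x then y1 / x - Num.sqrt (wall_F g d u x y1 y2 z)
  else (z + d * u * y2) / (g * y1).

(* Main.v *)
Require Import Defs.
From HB Require Import structures.
From mathcomp Require Import all_boot all_order all_algebra.
From mathcomp Require Import classical_sets reals.
From mathcomp Require Import complex ring lra.

Set Implicit Arguments.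
Unset Strict Implicit.
Unset Printing Implicit Defensive.

Import Order.TTheory GRing.Theory Num.Theory.
Local Open Scope classical_set_scope.
Local Open Scope ring_scope.

(** With denominators cleared, the equation of a pseudo-wall is affine in
    [s] and [s ^+ 2 + t ^+ 2].  When [x > 0], the power of the point
    [(y1 / x, 0)] with respect to every semicircular wall is [F]: its centre
    is [c = y1 / x - sqrt (rad ^+ 2 + F)], hence
    [`|C0 - c| = sqrt (rad ^+ 2 + F) - sqrt F < rad].  When [x = 0], all
    semicircular walls have the same centre [C0]. *)

Section IntersectionForm.
Variables (R : realType) (X : surface).
Implicit Types (D E H : NS X R).

Lemma dotDl D E H : dot (D + E) H = dot D H + dot E H.
Proof. by rewrite /dot /gram_dot !mulmxDl mxE. Qed.

Lemma dotZl (k : R) D H : dot (k *: D) H = k * dot D H.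
Proof. by rewrite /dot /gram_dot -!scalemxAl mxE. Qed.

Lemma dotC D E : dot D E = dot E D.
Proof.
rewrite /dot /gram_dot.
have -> : E *m map_mx intr (gram X) *m D^T = (D *m map_mx intr (gram X) *m E^T)^T.
  by rewrite !trmx_mul trmxK map_trmx gram_sym mulmxA.
by rewrite [RHS]mxE.
Qed.

Lemma dotDr D E H : dot H (D + E) = dot H D + dot H E.
Proof. by rewrite dotC dotDl !(dotC H). Qed.

Lemma dotZr (k : R) D H : dot H (k *: D) = k * dot H D.
Proof. by rewrite dotC dotZl (dotC H). Qed.

Lemma dot_NS_of_int (D E : NS X int) :
  dot (NS_of_int R D) (NS_of_int R E) = (dot D E)%:~R.
Proof.
rewrite /dot /gram_dot /NS_of_int map_trmx -!map_mxM mxE.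
(* The Gram matrix is mapped by [intr] even over [int], where that map is the identity. *)
by congr ((_ *m _ *m _) _ _)%:~R; apply/matrixP=> i j; rewrite mxE intz.
Qed.

Lemma ample_sqr_gt0 (H : NS X int) :
  ample H -> 0 < dot (NS_of_int R H) (NS_of_int R H).
Proof. by move=> aH; rewrite dot_NS_of_int ltr0z; exact: ample_dot_gt0. Qed.

End IntersectionForm.

(** Two points of the semicircle already fix [k0] and [k1] in terms of [p]; a point off it excludes
    [p = 0]. *)
Lemma semicircle_coefs (R : realFieldType) (k0 k1 p c rad : R) :
  0 < rad ->
  (forall s t, 0 < t ->
    k0 + k1 * s + p * (s ^+ 2 + t ^+ 2) = 0 <->
    (s - c) ^+ 2 + t ^+ 2 = rad ^+ 2) ->
  [/\ p != 0, k1 = - 2 * p * c & k0 = p * (c ^+ 2 - rad ^+ 2)].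
Proof.
move=> rad0 wallE.
have e1 : k0 + k1 * c + p * (c ^+ 2 + rad ^+ 2) = 0.
  by apply/(wallE _ _ rad0); ring.
(* The 3-4-5 triangle gives a second point without square roots; subtracting [e1] leaves a multiple
   of [rad * (k1 + 2 * p * c)]. *)
have e2 : k0 + k1 * (c + 3 / 5 * rad) +
    p * ((c + 3 / 5 * rad) ^+ 2 + (4 / 5 * rad) ^+ 2) = 0.
  by apply/wallE; [lra | field].
have k1E : k1 = - 2 * p * c.
  have : rad * (k1 + 2 * p * c) = 0 by lra.
  by move/eqP; rewrite mulf_eq0 gt_eqF //= => /eqP; lra.
have k0E : k0 = p * (c ^+ 2 - rad ^+ 2) by rewrite k1E in e1; lra.
split=> //; apply/eqP => p0.
(* If [p = 0], all coefficients vanish, so the equation would also hold at [(c, 2 * rad)]. *)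
have r20 : 0 < 2 * rad by lra.
have /(wallE _ _ r20) : k0 + k1 * c + p * (c ^+ 2 + (2 * rad) ^+ 2) = 0.
  by rewrite k0E k1E p0; ring.
have : 0 < rad ^+ 2 by rewrite exprn_gt0.
lra.
Qed.

Section WallEquation.
Variables (R : realType) (X : surface) (om ga : NS X R) (u : R).
Hypothesis ga_om : dot ga om = 0.

(* The real part of the charge at [s = t = 0] of a class [(r, th, z)] with
   [dot th ga = b]. *)
Definition wall_const (r b z : R) : R := - z + u * b - r / 2 * u ^+ 2 * dot ga ga.

Lemma plane_charge_Re (r z : R) (th : NS X R) (s t : R) :
  complex.Re (plane_charge om ga u (s, t) (r, th, z)) =
  wall_const r (dot th ga) z + s * dot th om
  - r / 2 * dot om om * (s ^+ 2 - t ^+ 2).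
Proof.
rewrite /= !(dotDl, dotDr, dotZl, dotZr) (dotC om ga) ga_om /wall_const.
by field.
Qed.

Lemma plane_charge_Im (r z : R) (th : NS X R) (s t : R) :
  complex.Im (plane_charge om ga u (s, t) (r, th, z)) =
  t * (dot th om - r * s * dot om om).
Proof.
rewrite /= -scaleNr !(dotDl, dotDr, dotZl, dotZr) ga_om.
by ring.
Qed.

(** Both imaginary parts carry a factor [t]. After dividing by it, the cubic terms and those in
    [s * a * a'] cancel by antisymmetry, and [s ^+ 2] combines with half of [s ^+ 2 - t ^+ 2] into
    half of [s ^+ 2 + t ^+ 2]. *)
Lemma pseudo_wallE (x z r z' : R) (th th' : NS X R) (s t : R) :
  let cv := wall_const x (dot th ga) z in
  let cw := wall_const r (dot th' ga) z' in
  let a := dot th om in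
  let a' := dot th' om in
  0 < t ->
  pseudo_wall om ga u (x, th, z) (r, th', z') (s, t) <->
  (cw * a - cv * a') + dot om om * (cv * r - cw * x) * s
    + dot om om / 2 * (r * a - x * a') * (s ^+ 2 + t ^+ 2) = 0.
Proof.
move=> cv cw a a' t0.
rewrite -[pseudo_wall _ _ _ _ _ _]/(0 < t /\ same_slope _ _ _) /same_slope.
rewrite !plane_charge_Re !plane_charge_Im -/cv -/cw -/a -/a'.
set e := (X in _ <-> X = 0).
set L := (X in _ /\ X = _); set L' := (X in _ /\ _ = X).
have LE : L - L' = - t * e by rewrite /L /L' /e; field.
split=> [[_ LL']|e0].
  have /eqP : - t * e = 0 by rewrite -LE LL' subrr.
  by rewrite mulf_eq0 oppr_eq0 gt_eqF //= => /eqP.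
by split=> //; apply/eqP; rewrite -subr_eq0 LE e0 mulr0.
Qed.

End WallEquation.

Theorem corollary2p8 (R : realType) (X : surface)
    (omega : NS X int) (gamma : NS X rat)
    (x y1 y2 z u : R) (alpha : NS X R) :
  let om : NS X R := NS_of_int R omega in
  let ga : NS X R := NS_of_rat R gamma in
  let g : R := dot om om in
  let d : R := - dot ga ga in
  let v : NR X R := (x, y1 *: om + y2 *: ga + alpha, z) in
  ample omega ->
  dot ga om = 0 ->
  (gamma = 0 -> y2 = 0) ->
  dot alpha om = 0 ->
  dot alpha ga = 0 ->
  bogomolov v ->
  (0 < x /\ 0 < wall_F g d u x y1 y2 z) \/ (x = 0 /\ 0 < y1) ->
  forall w : NR X R,
    ~ proportional v w ->
    semicircular (pseudo_wall om ga u v w) ->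
    (0 < x -> pseudo_wall om ga u v w `<=` [set p | p.1 < y1 / x]) ->
    pseudo_wall om ga u v w `&` [set p | p.1 = wall_C0 g d u x y1 y2 z]
      !=set0.
Proof.
move=> om ga g d v aH ga_om _ al_om al_ga _ hyp [[r th'] z'] _.
have g0 : 0 < g by exact: ample_sqr_gt0.
set th := y1 *: om + y2 *: ga + alpha in v *.
have thom : dot th om = y1 * g.
  by rewrite !(dotDl, dotZl) ga_om al_om -/g; ring.
have thga : dot th ga = - y2 * d.
  by rewrite !(dotDl, dotZl) (dotC om) ga_om al_ga /d; ring.
move=> [c [rad [rad0 WE]]] left_of.
set cv := wall_const ga u x (dot th ga) z.
have cvE : cv = - z - u * y2 * d + x / 2 * u ^+ 2 * d.
  by rewrite /cv /wall_const thga /d; ring.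
have wallE s t : 0 < t ->
    pseudo_wall om ga u v (r, th', z') (s, t) <->
    (s - c) ^+ 2 + t ^+ 2 = rad ^+ 2.
  by move=> t0; rewrite WE /half_plane /=; split=> [[]|].
have [] := semicircle_coefs (c := c) rad0 (fun s t t0 =>
  iff_trans (iff_sym (pseudo_wallE u ga_om x z r z' th th' s t0)) (wallE s t t0)).
rewrite -/g -/cv thom.
set cw := wall_const _ _ r _ _; set a' := dot th' om => p_neq0 k1E k0E.
case: hyp => [[x0 F0]|[x0 y10]]; last first.
  (* The centre lies on the line [s = C0], so the top of the semicircle is the witness. *)
  exists (c, rad); split; first by apply/(wallE _ _ rad0); ring.
  rewrite /= /wall_C0 x0 ltxx.
  have r0 : r != 0 by apply: contraNneq p_neq0 => r0; rewrite r0 x0; apply/eqP; ring.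
  have : g * r * (cv + y1 * g * c) = 0.
    by move: k1E; rewrite x0; lra.
  move/eqP; rewrite !mulf_eq0 gt_eqF //= (negPf r0) /= => /eqP.
  rewrite cvE x0 => h.
  have gy0 : g * y1 != 0 by rewrite mulf_neq0 ?gt_eqF.
  by apply: (mulIf gy0); rewrite divfK //; lra.
set F := wall_F g d u x y1 y2 z in F0.
set m := y1 / x.
have FE : F = m ^+ 2 + 2 / (g * x) * cv.
  rewrite /F /wall_F cvE /m; field.
  by rewrite !gt_eqF.
have y1E : y1 = m * x by rewrite /m divfK // gt_eqF.
have pow : (m - c) ^+ 2 - rad ^+ 2 = F.
  (* Formally, the charge of [v] vanishes at [s = m], [t ^+ 2 = - F], so every wall equation holds
     there; this is that equation. *)
  have : (g / 2 * (r * (y1 * g) - x * a')) *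
      ((m - c) ^+ 2 - rad ^+ 2 - F) = 0.
    have -> : forall p : R, p * ((m - c) ^+ 2 - rad ^+ 2 - F) =
        p * (c ^+ 2 - rad ^+ 2) + (- 2 * p * c) * m + p * (m ^+ 2 - F).
      by move=> p; ring.
    rewrite -k0E -k1E FE y1E; field.
    by rewrite !gt_eqF.
  by move/eqP; rewrite mulf_eq0 (negPf p_neq0) /= subr_eq0 => /eqP.
(* The region hypothesis, applied to the top of the semicircle, fixes the sign of [m - c]. *)
have cm : c < m.
  apply: (left_of x0 (c, rad)).
  by apply/(wallE _ _ rad0); ring.
have sF0 : 0 < Num.sqrt F by rewrite sqrtr_gt0.
have sFE : Num.sqrt F ^+ 2 = F by rewrite sqr_sqrtr // ltW.
rewrite /wall_C0 x0 -/F -/m; set C := Num.sqrt F in sF0 sFE *.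
have rad2_gt0 : 0 < rad ^+ 2 by rewrite exprn_gt0.
have CmC : C < m - c.
  by rewrite -(ltr_pXn2r (n := 2)) ?nnegrE ?subr_ge0 ?ltW //; lra.
(* This is the square of the height at which the line meets the wall; by [pow] it factors into
   positive terms. *)
have t2_gt0 : 0 < rad ^+ 2 - (m - C - c) ^+ 2.
  have -> : rad ^+ 2 - (m - C - c) ^+ 2 = 2 * (C * (m - c - C)) by lra.
  by rewrite !mulr_gt0 // subr_gt0.
exists (m - C, Num.sqrt (rad ^+ 2 - (m - C - c) ^+ 2)); split=> //.
apply/wallE; first by rewrite sqrtr_gt0.
by rewrite sqr_sqrtr ?ltW //; ring.
Qed.
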